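(* For every partition $\lambda$ and all integers $k,l\ge 0$, $$HS_{\lambda}(X;Y)=\sum_{\alpha:\ \boldsymbol{\lambda}(\alpha)=\lambda}\mathcal{HQ}_{\alpha}(X;Y),$$ where the sum runs over all compositions $\alpha$ whose parts, sorted into weakly decreasing order, give $\lambda$.
   Context: Fix integers $k,l\ge 0$, let $\mathcal{A}=\{1,\dots,k\}$, $\mathcal{A}'=\{1',\dots,l'\}$, totally ordered by $1<2<\dots<k<1'<2'<\dots<l'$, and let $X=(x_1,\dots,x_k)$, $Y=(y_1,\dots,y_l)$. Diagrams use French notation: row $i$ is the $i$-th row from the bottom, and cell $(i,j)$ is in row $i$, column $j$ (from the left). A $(k,l)$-semistandard hook tableau (SSHT) of shape a partition $\lambda$ is a filling of the Young diagram of $\lambda$ (with $\lambda_i$ cells in row $i$) with letters from $\mathcal{A}\cup\mathcal{A}'$ such that all rows (left to right) and columns (bottom to top) weakly increase, unprimed entries weakly increase along rows and strictly increase up columns, and primed entries strictly increase along rows and weakly increase up columns. The hook Schur function is $HS_\lambda(X;Y)=\sum_T \prod_i x_i^{v_i}\prod_i y_i^{u_i}$ over all SSHT $T$ of shape $\lambda$, where $v_i$ (resp. $u_i$) is the number of entries $i$ (resp. $i'$) of $T$. For a composition $\alpha=(\alpha_1,\dots,\alpha_r)$ with largest part $m$, its diagram has $\alpha_i$ cells in row $i$. A hook composition tableau (HCT) of shape $\alpha$ is a filling $F$ of this diagram with letters of $\mathcal{A}\cup\mathcal{A}'$ such that: (1) entries weakly increase along each row from left to right; (2) the unprimed entries weakly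 increase and the primed entries strictly increase along each row from left to right; (3) in the leftmost column, the unprimed entries strictly increase and the primed entries weakly increase from bottom to top; (4) (triple rule) let $\hat F$ be $F$ extended to an $r\times m$ rectangle by putting $\infty$ (larger than every letter, and in neither $\mathcal{A}$ nor $\mathcal{A}'$) in each added cell; then for all $1\le i<j\le r$ and $1\le n<m$: (a) if $\hat F(i,n+1)\in\mathcal{A}$ and $\hat F(i,n+1)\ge \hat F(j,n)$ then $\hat F(i,n+1)>\hat F(j,n+1)$; (b) if $\hat F(i,n+1)\in\mathcal{A}'$ and $\hat F(i,n+1)>\hat F(j,n)$ then $\hat F(i,n+1)\ge\hat F(j,n+1)$. The quasisymmetric hook Schur function is $\mathcal{HQ}_\alpha(X;Y)=\sum_F\prod_i x_i^{v_i}\prod_i y_i^{u_i}$ over all HCT $F$ of shape $\alpha$, with $v_i,u_i$ the numbers of entries $i$, $i'$ in $F$.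
   Formalization: In condition (3) for HCTs the leftmost column is also required to weakly increase as a whole (no unprimed entry above a primed one); without this the identity fails for λ=(1,1), k=l=1, where the two sides are xy+y² and 2xy+y². *)

(* Defs.v *)
From mathcomp Require Export all_boot all_order all_algebra.
From mathcomp Require Export mpoly.

Set Implicit Arguments.
Unset Strict Implicit.
Unset Printing Implicit Defensive.

Import GRing.Theory.

Definition is_composition (s : seq nat) : bool := 0 \notin s.

Definition is_partition (s : seq nat) : bool := sorted geq s && (0 \notin s).

Definition sort_parts (s : seq nat) : seq nat := sort geq s.

(* A duplicate-free enumeration (see permutations_uniq) of the compositions   *)
(* that sort to a given partition; mem_compositions_sorting_to is its         *)
(* specification.                                                             *)
Definition compositions_sorting_to (lam : seq nat) : seq (seq nat) :=
  permutations lam.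

Lemma mem_compositions_sorting_to (lam alpha : seq nat) :
  is_partition lam ->
  (alpha \in compositions_sorting_to lam) =
  is_composition alpha && (sort_parts alpha == lam).
Proof.
move=> /andP[lam_sorted lam_pos].
have geq_total : total geq by move=> m n; apply: leq_total.
have geq_trans : transitive geq by move=> n m p /= nm pn; apply: leq_trans nm.
have geq_anti : antisymmetric geq.
  by move=> m n /= mn; apply/anti_leq; rewrite andbC.
rewrite mem_permutations; apply/idP/andP=> [perm_al|[_ /eqP <-]]; last first.
  by rewrite perm_sym perm_sort.
split; first by rewrite /is_composition (perm_mem perm_al).
apply/eqP/(sorted_eq geq_trans geq_anti) => //; first exact: sort_sorted.
by rewrite /sort_parts perm_sort.
Qed.

Definition largest_part (s : seq nat) : nat := \max_(a <- s) a.

(* inl i stands for the unprimed letter i+1, inr j for (j+1)'        *)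
Definition letter (k l : nat) : Type := ('I_k + 'I_l)%type.

Definition is_unprimed (k l : nat) (a : letter k l) : bool :=
  if a is inl _ then true else false.

Definition is_primed (k l : nat) (a : letter k l) : bool :=
  if a is inr _ then true else false.

(* unsplit sends inl i to i and inr j to k + j, hence 1 < .. < k < 1' < .. *)
Definition le_letter (k l : nat) (a b : letter k l) : bool :=
  (unsplit a <= unsplit b)%N.

Definition lt_letter (k l : nat) (a b : letter k l) : bool :=
  (unsplit a < unsplit b)%N.

(* None is infinity, larger than every letter. *)
Definition xlt (k l : nat) (a b : option (letter k l)) : bool :=
  match a, b with
  | Some a, Some b => lt_letter a b
  | Some _, None => true
  | None, _ => false
  end.

Definition xle (k l : nat) (a b : option (letter k l)) : bool := ~~ xlt b a.

(* Rows (numbered from the bottom) and columns start at 0. *)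
Definition cell (s : seq nat) : Type := {i : 'I_(size s) & 'I_(nth 0 s i)}.

Definition cell_row (s : seq nat) (c : cell s) : nat := tag c.
Definition cell_col (s : seq nat) (c : cell s) : nat := tagged c.

Definition filling (s : seq nat) (k l : nat) : Type :=
  {ffun cell s -> letter k l}.

Definition left_of (s : seq nat) (c d : cell s) : bool :=
  (cell_row c == cell_row d) && (cell_col c < cell_col d)%N.

Definition below (s : seq nat) (c d : cell s) : bool :=
  (cell_col c == cell_col d) && (cell_row c < cell_row d)%N.

Definition row_increase (k l : nat) (a b : letter k l) : bool :=
  [&& le_letter a b,
      is_unprimed a && is_unprimed b ==> le_letter a b
    & is_primed a && is_primed b ==> lt_letter a b].

Definition column_increase (k l : nat) (a b : letter k l) : bool :=
  [&& le_letter a b,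
      is_unprimed a && is_unprimed b ==> lt_letter a b
    & is_primed a && is_primed b ==> le_letter a b].

Definition is_SSHT (s : seq nat) (k l : nat) (T : filling s k l) : bool :=
  [forall c : cell s, forall d : cell s, left_of c d ==> row_increase (T c) (T d)]
  && [forall c : cell s, forall d : cell s,
        below c d ==> column_increase (T c) (T d)].

(* Entry (i, j) of F extended by infinity outside of the diagram of s. *)
Definition extend (s : seq nat) (k l : nat) (F : filling s k l) (i j : nat) :
    option (letter k l) :=
  omap F [pick c : cell s | (cell_row c == i) && (cell_col c == j)].

Definition triple_rule (s : seq nat) (k l : nat) (F : filling s k l) : bool :=
  [forall i : 'I_(size s), forall j : 'I_(size s),
     forall n : 'I_(largest_part s),
     (i < j)%N && (n.+1 < largest_part s)%N ==>
     match extend F i n.+1 with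
     | Some (inl _) =>
         xle (extend F j n) (extend F i n.+1)
           ==> xlt (extend F j n.+1) (extend F i n.+1)
     | Some (inr _) =>
         xlt (extend F j n) (extend F i n.+1)
           ==> xle (extend F j n.+1) (extend F i n.+1)
     | None => true
     end].

(* The leftmost column is weakly increasing as a whole (an unprimed entry     *)
(* never lies above a primed one), which column_increase includes.            *)
Definition is_HCT (s : seq nat) (k l : nat) (F : filling s k l) : bool :=
  [&& [forall c : cell s, forall d : cell s,
         left_of c d ==> row_increase (F c) (F d)],
      [forall c : cell s, forall d : cell s,
         below c d && (cell_col c == 0) ==> column_increase (F c) (F d)]
    & triple_rule F].

Definition varx (k l : nat) (i : 'I_k) : {mpoly int[k + l]} := 'X_(lshift l i).
Definition vary (k l : nat) (j : 'I_l) : {mpoly int[k + l]} := 'X_(rshift k j).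

Definition mult (s : seq nat) (k l : nat) (F : filling s k l) (a : letter k l) :
    nat := #|[set c | F c == a]|.

Definition weight (s : seq nat) (k l : nat) (F : filling s k l) :
    {mpoly int[k + l]} :=
  ((\prod_(i < k) varx l i ^+ mult F (inl i)) *
   (\prod_(j < l) vary k j ^+ mult F (inr j)))%R.

Definition HS (k l : nat) (lam : seq nat) : {mpoly int[k + l]} :=
  (\sum_(T : filling lam k l | is_SSHT T) weight T)%R.

Definition HQ (k l : nat) (alpha : seq nat) : {mpoly int[k + l]} :=
  (\sum_(F : filling alpha k l | is_HCT F) weight F)%R.

(* Main.v *)
Require Import Defs.
From mathcomp Require Import all_fingroup zify.

Set Implicit Arguments.
Unset Strict Implicit.
Unset Printing Implicit Defensive.

Import GRing.Theory.

(** Sorting every column of a hook composition tableau gives a semistandard hook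
tableau with the same column multisets, hence the same weight.  Conversely the
column multisets determine the hook composition tableau: its first column is
sorted, and given column c there is exactly one arrangement of column c+1 that
satisfies the row and triple conditions.  An arrangement exists because, among
those valid along rows, one with least sum_i i * v_i satisfies the triple rule;
it is unique by looking at the least letter that two arrangements place
differently.  Padding all diagrams with infinities to a common rectangle makes
the shape a function of the filling, so all compositions are treated at once. *)

(** * Single columns and pairs of adjacent columns, with letters coded as numbers *)

Section Columns.

Variables (k N : nat).
Implicit Types (a b c : nat) (u v w p q : 'I_N -> nat) (G T : nat -> 'I_N -> nat).

(** The numbers below [k] code the unprimed letters. The negation of [row_rel b a] is the condition
    for [b] to stand above [a] in a column, so one relation serves rows, columns and triples. *)
Definition row_rel a b := if b < k then a <= b else a < b.

Lemma row_relW a b : row_rel a b -> a <= b.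
Proof. rewrite /row_rel; case: ifP; lia. Qed.

Lemma row_rel_mono a a' b b' : a' <= a -> b <= b' -> row_rel a b -> row_rel a' b'.
Proof. rewrite /row_rel; case: ifP; case: ifP; lia. Qed.

Lemma row_rel_trans : transitive row_rel.
Proof. move=> b a c /row_relW ab; exact: row_rel_mono. Qed.

Lemma row_rel_total a b : ~~ row_rel b a -> a <= b.
Proof. rewrite /row_rel; case: ifP; lia. Qed.

Definition column_strict w := forall i j : 'I_N, i < j -> ~~ row_rel (w j) (w i).

(** Triple conditions (a) and (b) are the cases [v i < k] and [k <= v i] of the second clause. *)
Definition triple_step u v :=
  (forall i, row_rel (u i) (v i)) /\
  (forall i j : 'I_N, i < j -> row_rel (u j) (v i) -> ~~ row_rel (v i) (v j)).

(** The trace of the column conditions that survives any rearrangement of a column; both sorting and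
    the construction of [triple_step] start from it. *)
Definition unprimed_distinct w := forall i j, w i = w j -> i != j -> k <= w i.

Lemma column_strict_distinct w : column_strict w -> unprimed_distinct w.
Proof.
move=> ws i j eij; rewrite neq_ltn => /orP[] /ws; rewrite eij /row_rel;
  case: ifP; lia.
Qed.

(** If [v i = v j], the row condition at [j] is the premise of the triple condition, whose
    conclusion denies [row_rel a a] for the common value [a]; this forces [k <= a]. *)
Lemma triple_step_distinct u v : triple_step u v -> unprimed_distinct v.
Proof.
move=> [uv tr] i j; wlog ltij : i j / i < j.
  move=> W eij; rewrite neq_ltn => /orP[] lt.
    by apply: (W _ _ lt) => //; rewrite neq_ltn lt.
  by rewrite eij; apply: (W _ _ lt) => //; rewrite neq_ltn lt.
move=> eij _; have := tr _ _ ltij; rewrite eij => /(_ (uv j)).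
rewrite /row_rel; case: ifP; lia.
Qed.

Definition column w := [seq w i | i <- enum 'I_N].

Lemma size_column w : size (column w) = N.
Proof. by rewrite size_map size_enum_ord. Qed.

Lemma nth_column w (i : 'I_N) : nth 0 (column w) i = w i.
Proof. by rewrite (nth_map i) ?nth_ord_enum // size_enum_ord. Qed.

Lemma column_inj w w' : column w = column w' -> w =1 w'.
Proof. by move=> e i; rewrite -(nth_column w) e nth_column. Qed.

Lemma perm_column w (s : 'S_N) : perm_eq (column (w \o s)) (column w).
Proof.
rewrite /column (map_comp w s); apply: perm_map.
apply: uniq_perm; rewrite ?enum_uniq //.
  by rewrite (map_inj_uniq (@perm_inj _ s)) enum_uniq.
move=> i; rewrite mem_enum inE; apply/mapP; exists ((s^-1)%g i).
  by rewrite mem_enum.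
by rewrite permKV.
Qed.

Lemma perm_columnP w w' : perm_eq (column w) (column w') ->
  exists s : 'S_N, forall i, w i = w' (s i).
Proof.
have -> : column w = [tuple of [tuple w i | i < N]] by [].
have -> : column w' = [tuple of [tuple w' i | i < N]] by [].
case/tuple_permP => s e; exists s => i.
have /= := congr1 (fun x => nth 0 x i) e.
by rewrite -[X in nth 0 X i]/(column w) nth_column => ->;
  rewrite -[X in nth 0 X i]/(column _) nth_column !tnth_mktuple.
Qed.

(* Look at the least letter whose positions in v and v' differ. *)
Lemma triple_step_inj u v v' : triple_step u v -> triple_step u v' ->
  perm_eq (column v) (column v') -> v =1 v'.
Proof.
move=> [uv tr] [uv' tr'] pvv'.
have cnt (a : nat) : #|[set i | v i == a]| = #|[set i | v' i == a]|.
  have H w : #|[set i | w i == a]| = count (pred1 a) (column w).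
    rewrite cardE size_filter count_map enumT; apply: eq_count => i.
    by rewrite !inE.
  by rewrite !H; apply/seq.permP.
suff E (a : nat) : [set i | v i == a] = [set i | v' i == a].
  by move=> i; have /setP /(_ i) := E (v i); rewrite !inE eqxx => /esym/eqP.
elim/ltn_ind: a => a IH.
(* As [x' j = a], the letter [a] may follow [u j], so the triple condition for [x] yields
   [x j <= a]. A smaller value would be shared with [x'], where row [j] holds [a]. *)
have step (x x' : 'I_N -> nat) (i j : 'I_N) : triple_step u x -> triple_step u x' ->
    (forall b, b < a -> [set i | x i == b] = [set i | x' i == b]) ->
    i < j -> x i = a -> x' j = a -> x j = a.
  move=> [ux tx] [ux' _] lo ltij xi xj; apply/eqP/contraT => xja.
  have := tx _ _ ltij; rewrite xi -{1}xj => /(_ (ux' j)) /row_rel_total.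
  rewrite leq_eqVlt (negPf xja) /= => /lo /setP /(_ j); rewrite !inE eqxx.
  by move=> /esym/eqP xj'; rewrite -xj' xj eqxx in xja.
(* Both position sets of [a] have the same size, so if they differ, each has a row outside the
   other; [step], applied from the lower of these two rows, gives the contradiction. *)
apply/eqP; rewrite eqEcard cnt leqnn andbT; apply/contraT => /subsetPn[i].
rewrite !inE => /eqP vi v'i.
have : ~~ ([set i | v' i == a] \subset [set i | v i == a]).
  apply: contraNN v'i => sub.
  have /eqP/setP/(_ i) : [set i | v' i == a] == [set i | v i == a].
    by rewrite eqEcard sub cnt leqnn.
  by rewrite !inE vi eqxx.
move=> /subsetPn[j]; rewrite !inE => /eqP v'j vj.
have := leqnn i; case: (ltngtP i j) => [lt|lt|/val_inj ij] _.
- by rewrite (step v v' i j) ?eqxx in vj.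
- rewrite (step v' v j i) ?eqxx // in v'i => b ba.
  by rewrite IH.
- by rewrite ij v'j eqxx in v'i.
Qed.

(* Swapping a violating pair keeps the rows valid and lowers sum_i i * v_i. *)
Lemma triple_step_exists p q (s0 : 'S_N) :
  (forall i, row_rel (p i) (q i)) -> unprimed_distinct q ->
  exists s : 'S_N, triple_step (p \o s0) (q \o s).
Proof.
move=> pq dq.
pose ok (s : 'S_N) := [forall i, row_rel (p (s0 i)) (q (s i))].
pose pot (s : 'S_N) := \sum_(i < N) i * q (s i).
have ok0 : ok s0 by apply/forallP => i; apply: pq.
case: (arg_minnP pot ok0) => s /forallP oks mins; exists s; split => //= i j ltij.
move=> ruj; apply/negP => rij.
have nij : i != j by rewrite neq_ltn ltij.
(* Equal entries would be primed by [dq], and a primed letter cannot follow itself in a row. *)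
have lt : q (s i) < q (s j).
  move: (row_relW rij); rewrite leq_eqVlt => /orP[/eqP e|//].
  have := dq _ _ e; rewrite (inj_eq perm_inj) => /(_ nij).
  by move: rij; rewrite e /row_rel; case: ifP; lia.
have := mins (tperm i j * s)%g; rewrite /ok => H.
have {}H : pot s <= pot (tperm i j * s)%g.
  apply: H; apply/forallP => x; rewrite permM; case: tpermP => [->|->|_ _] //.
  exact: row_rel_mono (leqnn _) (ltnW lt) (oks i).
(* Only the terms [i] and [j] change, and the sum drops by [(j - i) * (q (s j) - q (s i))]. *)
move: H; rewrite /pot (bigD1 i) //= (bigD1 j) 1?eq_sym //=.
rewrite [X in _ <= X](bigD1 i) //= [X in _ <= _ + X](bigD1 j) 1?eq_sym //=.
rewrite !permM tpermL tpermR.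
rewrite [X in _ <= _ + (_ + X)](eq_bigr (fun x : 'I_N => x * q (s x))); last first.
  by move=> x /andP[xi xj]; rewrite permM tpermD // eq_sym.
nia.
Qed.

(** * Sorting a column *)

Definition sorted_column w (i : 'I_N) := nth 0 (sort leq (column w)) i.

Lemma column_sorted_column w : column (sorted_column w) = sort leq (column w).
Proof.
apply: (@eq_from_nth _ 0); rewrite size_column ?size_sort ?size_column // => i iN.
by rewrite -[i]/(val (Ordinal iN)) nth_column.
Qed.

Lemma sorted_columnP w : exists s : 'S_N, forall i, sorted_column w i = w (s i).
Proof. by apply: perm_columnP; rewrite column_sorted_column perm_sort. Qed.

Lemma sorted_column_leq w (i j : 'I_N) :
  i <= j -> sorted_column w i <= sorted_column w j.
Proof.
move=> ij; apply: (sorted_leq_nth leq_trans leqnn) => //.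
- exact: (sort_sorted leq_total).
- by rewrite inE size_sort size_column.
- by rewrite inE size_sort size_column.
Qed.

Lemma sorted_column_strict w : unprimed_distinct w -> column_strict (sorted_column w).
Proof.
move=> dw i j ij; have := sorted_column_leq w (ltnW ij).
have [s es] := sorted_columnP w; rewrite !es => le.
have nij : s i != s j by rewrite (inj_eq perm_inj) neq_ltn ij.
move: (dw (s i) (s j)) => /(_ _ nij); rewrite /row_rel.
case: ifP; lia.
Qed.

Lemma column_strict_sorted w : column_strict w -> sort leq (column w) = column w.
Proof.
move=> ws; apply: (sorted_sort leq_trans).
apply/(sortedP 0) => i; rewrite size_column => iN.
have iN' := ltnW iN.
rewrite -[i.+1]/(val (Ordinal iN)) nth_column -[i]/(val (Ordinal iN')) nth_column.
by apply: row_rel_total; apply: ws.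
Qed.

(** In a sorted list, a downward closed predicate holds on an initial segment, whose length is its
    count. *)
Lemma nth_sorted_count (P : pred nat) (s : seq nat) i :
  (forall a b, a <= b -> P b -> P a) -> sorted leq s -> i < size s ->
  P (nth 0 s i) = (i < count P s).
Proof.
move=> dP; elim: s i => [//|a s IH] [|i] /= ps.
  case: (boolP (P a)) => //= nPa _; apply/esym/negbTE.
  rewrite -leqNgt leqn0 -[_ == 0]negbK -lt0n -has_count; apply/hasPn => b bs.
  apply: contraNN nPa; apply: dP.
  by move/allP: (order_path_min leq_trans ps) => /(_ _ bs).
rewrite ltnS => /(IH _ (path_sorted ps)) ->; case: (boolP (P a)) => //= nPa.
have -> : count P s = 0; last by rewrite !ltn0.
apply/eqP; rewrite -[_ == 0]negbK -lt0n -has_count; apply/hasPn => b bs.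
apply: contraNN nPa; apply: dP.
by move/allP: (order_path_min leq_trans ps) => /(_ _ bs).
Qed.

(** At least [i + 1] entries of [v] are at most [y], and their left neighbours in [u] may all
    precede [y]. Since [row_rel^~ y] is downward closed, the entry of rank [i] of [u] is among those
    that may. *)
Lemma sorted_column_row u v : (forall i, row_rel (u i) (v i)) ->
  forall i, row_rel (sorted_column u i) (sorted_column v i).
Proof.
move=> uv i; set y := sorted_column v i.
have sz w : i < size (sort leq (column w)) by rewrite size_sort size_column.
have srt w := sort_sorted leq_total (column w).
have -> : row_rel (sorted_column u i) y = (i < count (row_rel^~ y) (column u)).
  rewrite -(count_sort leq); apply: (@nth_sorted_count (row_rel^~ y)) => // a b ab.
  exact: row_rel_mono.
have : i < count (leq^~ y) (column v).
  rewrite -(count_sort leq) -(@nth_sorted_count (leq^~ y)) // => a b; lia.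
move=> /leq_trans; apply; rewrite !count_map; apply: sub_count => j /= vy.
exact: row_rel_mono (leqnn _) vy (uv j).
Qed.

(** * Rectangles with [B] columns and their column multisets *)

Variable B : nat.

(** The first argument of [G] is the column and the second the row; columns from [B] on are
    ignored. *)
Definition SSHT_rect G :=
  (forall c, c < B -> column_strict (G c)) /\
  (forall c, c.+1 < B -> forall i, row_rel (G c i) (G c.+1 i)).

Definition HCT_rect G :=
  (0 < B -> column_strict (G 0)) /\
  (forall c, c.+1 < B -> triple_step (G c) (G c.+1)).

(** Sorting is a normal form that turns equality of column multisets into plain equality. *)
Definition sorted_columns G := [seq sort leq (column (G c)) | c <- iota 0 B].

Lemma sorted_columnsP G G' :
  sorted_columns G = sorted_columns G' <->
  forall c, c < B -> perm_eq (column (G c)) (column (G' c)).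
Proof.
have P := perm_sortP leq_total leq_trans anti_leq.
split=> [/eq_in_map E c cB|E].
  by apply/P/E; rewrite mem_iota.
by apply/eq_in_map => c; rewrite mem_iota => /andP[_ cB]; apply/P/E.
Qed.

Lemma SSHT_rect_inj G G' : SSHT_rect G -> SSHT_rect G' ->
  sorted_columns G = sorted_columns G' -> forall c, c < B -> G c =1 G' c.
Proof.
move=> [sG _] [sG' _] /eq_in_map E c cB; apply: column_inj.
rewrite -(column_strict_sorted (sG _ cB)) -(column_strict_sorted (sG' _ cB)).
by apply: E; rewrite mem_iota.
Qed.

Lemma triple_step_ext u u' v : u =1 u' -> triple_step u v -> triple_step u' v.
Proof.
move=> e [h1 h2]; split=> [i|i j]; first by rewrite -e.
by rewrite -e; apply: h2.
Qed.

Lemma HCT_rect_inj G G' : HCT_rect G -> HCT_rect G' ->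
  sorted_columns G = sorted_columns G' -> forall c, c < B -> G c =1 G' c.
Proof.
move=> [s0 tr] [s0' tr'] /sorted_columnsP E; elim=> [|c IH] cB.
  apply: column_inj; rewrite -(column_strict_sorted (s0 cB)).
  rewrite -(column_strict_sorted (s0' cB)).
  by apply/(perm_sortP leq_total leq_trans anti_leq)/E.
apply: (@triple_step_inj (G c)); rewrite ?E //; first exact: tr.
apply: triple_step_ext (tr' _ cB) => i; rewrite IH //; exact: ltnW.
Qed.

Lemma HCT_rect_distinct G c : HCT_rect G -> c < B -> unprimed_distinct (G c).
Proof.
move=> [s0 tr]; case: c => [/s0|c cB]; first exact: column_strict_distinct.
exact: triple_step_distinct (tr _ cB).
Qed.

Lemma HCT_rect_sort G : HCT_rect G -> SSHT_rect (fun c => sorted_column (G c)).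
Proof.
move=> hG; split=> c cB.
  by apply: sorted_column_strict; apply: HCT_rect_distinct.
by apply: sorted_column_row; case: hG => _ /(_ _ cB)[].
Qed.

Lemma SSHT_rect_shuffle T : SSHT_rect T ->
  exists s : nat -> 'S_N, HCT_rect (fun c => T c \o s c).
Proof.
move=> [sT rT].
(* Columns are rearranged one by one from the left. Column 0 is already strict, hence the identity
   there; [b] counts the further columns treated. *)
suff H b : exists s : nat -> 'S_N, s 0 = 1%g /\
    forall c, c < b -> c.+1 < B -> triple_step (T c \o s c) (T c.+1 \o s c.+1).
  have [s [s1 h]] := H B; exists s; rewrite /HCT_rect s1; split=> [B0|c cB].
    by move=> i j ij /=; rewrite !perm1; apply: sT.
  by apply: h => //; apply: ltnW.
elim: b => [|b [s [s1 IH]]]; first by exists (fun=> 1%g).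
case: (ltnP b.+1 B) => [bB|Bb]; last first.
  by exists s; split=> // c _ cB; apply: IH => //; lia.
have [t ht] := triple_step_exists (s b) (rT _ bB) (column_strict_distinct (sT _ bB)).
exists (fun c => if c == b.+1 then t else s c); split=> // c cb cB.
case: (ltngtP c b) => cb'; rewrite ?(ltn_eqF cb) ?eqSS; last first.
- by rewrite cb' eqxx.
- lia.
- by rewrite (ltn_eqF cb'); apply: IH.
Qed.

Lemma SSHT_rect_ext G G' : (forall c, c < B -> G c =1 G' c) -> SSHT_rect G -> SSHT_rect G'.
Proof.
move=> e [s r]; split=> c cB => [i j|i]; first by rewrite -!e //; apply: s.
by rewrite -!e //; [apply: r|apply: ltnW].
Qed.

Lemma HCT_rect_ext G G' : (forall c, c < B -> G c =1 G' c) -> HCT_rect G -> HCT_rect G'.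
Proof.
move=> e [s r]; split=> [B0 i j|c cB]; first by rewrite -!e //; apply: s.
have [h1 h2] := r _ cB; split=> [i|i j]; first by rewrite -!e //; exact: ltnW.
by rewrite -!e //; [apply: h2|apply: ltnW].
Qed.

Lemma HCT_rect_row G c i : HCT_rect G -> c.+1 < B -> row_rel (G c i) (G c.+1 i).
Proof. by move=> [_ tr] /tr[]. Qed.

End Columns.

(** * Tableaux as rectangles of numbers padded with infinities *)

Section Rectangles.

Variables (k l : nat).

Lemma row_increaseE (a b : letter k l) :
  row_increase a b = row_rel k (unsplit a) (unsplit b).
Proof.
rewrite /row_increase /le_letter /lt_letter /row_rel.
by case: a b => [a|a] [b|b] /=; have := ltn_ord a; have := ltn_ord b; case: ifP; lia.
Qed.

Lemma column_increaseE (a b : letter k l) :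
  column_increase a b = ~~ row_rel k (unsplit b) (unsplit a).
Proof.
rewrite /column_increase /le_letter /lt_letter /row_rel.
by case: a b => [a|a] [b|b] /=; have := ltn_ord a; have := ltn_ord b; case: ifP; lia.
Qed.

Section Filling.

Variables (s : seq nat) (F : filling s k l).

Lemma cell_col_lt (x : cell s) : cell_col x < nth 0 s (cell_row x).
Proof. exact: ltn_ord. Qed.

Lemma cell_inj (x y : cell s) :
  cell_row x = cell_row y -> cell_col x = cell_col y -> x = y.
Proof.
case: x y => [i c] [j d]; rewrite /cell_row /cell_col /= => /val_inj ij.
by case: j / ij d => d /val_inj ->.
Qed.

Lemma cell_exists i c : c < nth 0 s i ->
  exists x : cell s, cell_row x = i /\ cell_col x = c.
Proof.
move=> ci; have si : i < size s.
  by rewrite ltnNge; apply/negP => /(nth_default 0) e; rewrite e in ci.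
by exists (existT (fun i : 'I_(size s) => 'I_(nth 0 s i)) (Ordinal si) (Ordinal ci)).
Qed.

Lemma extend_cell (x : cell s) : extend F (cell_row x) (cell_col x) = Some (F x).
Proof.
rewrite /extend; case: pickP => [y /andP[/eqP r /eqP c]|/(_ x)].
  by rewrite (cell_inj r c).
by rewrite !eqxx.
Qed.

Lemma extend_out i c : nth 0 s i <= c -> extend F i c = None.
Proof.
move=> ic; rewrite /extend; case: pickP => // y /andP[/eqP r /eqP e].
by have := cell_col_lt y; rewrite r e ltnNge ic.
Qed.

(* Infinity in column c is encoded as the primed letter k + l + c, so that the
   rows of the rectangle keep increasing. *)
Definition rect N c (i : 'I_N) : nat :=
  if extend F i c is Some a then unsplit a : nat else k + l + c.

Lemma rect_cell N (x : cell s) (i : 'I_N) : cell_row x = i ->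
  rect (cell_col x) i = unsplit (F x).
Proof. by rewrite /rect => <-; rewrite extend_cell. Qed.

Lemma rect_out N c (i : 'I_N) : nth 0 s i <= c -> rect c i = k + l + c.
Proof. by move=> ic; rewrite /rect extend_out. Qed.

Lemma rect_lt N c (i : 'I_N) : (rect c i < k + l) = (c < nth 0 s i).
Proof.
case: (ltnP c (nth 0 s i)) => [/cell_exists[x [r <-]]|/rect_out ->]; last by lia.
by rewrite (rect_cell r) ltn_ord.
Qed.

Lemma rect_cases N c (i : 'I_N) : (rect c i < k + l) || (rect c i == k + l + c).
Proof. by rewrite rect_lt; case: (ltnP c) => //= /rect_out ->. Qed.

Variables (N : nat) (sN : size s = N).
Let B := largest_part s.

Lemma part_le i : nth 0 s i <= B.
Proof.
case: (ltnP i (size s)) => [lt|ge]; last by rewrite nth_default.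
by rewrite /B /largest_part (big_nth 0) big_mkord
  (leq_bigmax_cond (Ordinal lt)).
Qed.

Lemma cell_rowN (x : cell s) : cell_row x < N.
Proof. by rewrite -sN; apply: ltn_ord. Qed.

(** Adjacent columns suffice by transitivity of [row_rel]. An added cell in column [c.+1] exceeds
    every entry of column [c], so padding imposes no condition. *)
Lemma row_increaseP :
  (forall x y : cell s, left_of x y -> row_increase (F x) (F y)) <->
  (forall c, c.+1 < B -> forall i : 'I_N, row_rel k (rect c i) (rect c.+1 i)).
Proof.
split=> [H c _ i|H x y].
  case: (ltnP c.+1 (nth 0 s i)) => [lt|/rect_out ->].
    have [x [rx cx]] := cell_exists (ltnW lt).
    have [y [ry cy]] := cell_exists lt.
    rewrite -{1}cx -cy (rect_cell rx) (rect_cell ry) -row_increaseE.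
    by apply: H; rewrite /left_of rx ry cx cy eqxx /=.
  by have := rect_cases c i; rewrite /row_rel; case: ifP; lia.
move=> /andP[/eqP rxy cxy].
have rx : cell_row x = Ordinal (cell_rowN x) by [].
have ry : cell_row y = Ordinal (cell_rowN x) by rewrite -rxy.
rewrite row_increaseE -(rect_cell rx) -(rect_cell ry).
have := leq_trans (cell_col_lt y) (part_le _).
elim: (cell_col y) cxy => // c IH; rewrite ltnS leq_eqVlt => /orP[/eqP->|lt] cB.
  exact: H.
by apply: row_rel_trans (IH lt (ltnW cB)) _; apply: H.
Qed.

(** The hypothesis forbids gaps below a cell of column [c]: it holds in all columns of a partition
    and in the first column of a composition. The added cells on top share one code, which may
    repeat because it is at least [k]. *)
Lemma column_increaseP c :
  (forall i j, i < j < N -> c < nth 0 s j -> c < nth 0 s i) ->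
  (forall x y : cell s, below x y && (cell_col x == c) ->
     column_increase (F x) (F y)) <->
  column_strict k (rect (N := N) c).
Proof.
move=> down; split=> [H i j ij|H x y /andP[/andP[/eqP cxy rxy] /eqP cx]].
  case: (ltnP c (nth 0 s j)) => [lt|/rect_out ->]; last first.
    by have := rect_cases c i; rewrite /row_rel; case: ifP; lia.
  have [y [ry cy]] := cell_exists lt.
  have [|x [rx cx]] := @cell_exists i c; first by apply: down lt; rewrite ij ltn_ord.
  rewrite -{1}cy -cx (rect_cell rx) (rect_cell ry) -column_increaseE.
  by apply: H; rewrite /below rx ry cx cy !eqxx ij.
have rx : cell_row x = Ordinal (cell_rowN x) by [].
have ry : cell_row y = Ordinal (cell_rowN y) by [].
rewrite column_increaseE -(rect_cell rx) -(rect_cell ry) -cxy cx.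
exact: H.
Qed.

Lemma is_SSHT_rect : sorted geq s -> is_SSHT F <-> SSHT_rect k B (rect (N := N)).
Proof.
move=> s_sorted.
have down c i j : i < j < N -> c < nth 0 s j -> c < nth 0 s i.
  move=> /andP[ij jN] /leq_trans; apply.
  have geq_trans : transitive geq by move=> x y z /= xy yz; apply: leq_trans yz xy.
  have := sorted_ltn_nth geq_trans 0 s_sorted.
  by move=> /(_ i j); rewrite !inE sN; apply; rewrite // (ltn_trans ij).
split=> [/andP[/forallP rows /forallP cols]|[cols rows]].
  split=> [c cB|]; last first.
    by apply/row_increaseP => x y; move: (rows x) => /forallP/(_ y)/implyP.
  apply/column_increaseP; first exact: down.
  by move=> x y /andP[b _]; move: (cols x) => /forallP/(_ y)/implyP; apply.
apply/andP; split; apply/'forall_forallP => x y; apply/implyP.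
  by move: x y; apply/row_increaseP.
move=> b; have cB : cell_col x < B := leq_trans (cell_col_lt x) (part_le _).
by apply: (column_increaseP (down _)).2 (cols _ cB) _ _ _; rewrite b eqxx.
Qed.

Lemma triple_ruleP :
  triple_rule F <->
  (forall c, c.+1 < B -> forall i j : 'I_N, i < j ->
    row_rel k (rect c j) (rect c.+1 i) -> ~~ row_rel k (rect c.+1 i) (rect c.+1 j)).
Proof.
(* An infinity at [(i, c.+1)] is maximal in its column, so the right side holds too; against
   letters, the codes of infinity compare as infinity does. *)
have step (i j : 'I_N) c :
    match extend F i c.+1 with
    | Some (inl _) =>
        xle (extend F j c) (extend F i c.+1) ==> xlt (extend F j c.+1) (extend F i c.+1)
    | Some (inr _) =>
        xlt (extend F j c) (extend F i c.+1) ==> xle (extend F j c.+1) (extend F i c.+1)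
    | None => true
    end = (row_rel k (rect c j) (rect c.+1 i) ==>
           ~~ row_rel k (rect c.+1 i) (rect c.+1 j)).
  have := rect_cases c j; have := rect_cases c.+1 j; have := rect_cases c.+1 i.
  rewrite /rect /xle /xlt /lt_letter /row_rel.
  case: (extend F i c.+1) => [[a|a]|]; case: (extend F j c.+1) => [b|];
  case: (extend F j c) => [d|] /=; try have := ltn_ord a;
  try have := ltn_ord (unsplit b); try have := ltn_ord (unsplit d);
  by do ?[case: ifP]; lia.
split=> [/forallP H c cB i j ij|H].
  have iN : i < size s by rewrite sN.
  have jN : j < size s by rewrite sN.
  move: (H (Ordinal iN)) => /forallP/(_ (Ordinal jN))/forallP/(_ (Ordinal (ltnW cB))).
  by rewrite /= cB ij /= step => /implyP.
apply/forallP => i; apply/forallP => j; apply/forallP => c.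
apply/implyP => /andP[ij cB].
have iN : i < N by rewrite -sN.
have jN : j < N by rewrite -sN.
have := step (Ordinal iN) (Ordinal jN) c; rewrite /= => ->.
by apply/implyP; apply: H.
Qed.

Lemma is_HCT_rect : 0 \notin s -> is_HCT F <-> HCT_rect k B (rect (N := N)).
Proof.
move=> s_pos.
have down i j : i < j < N -> 0 < nth 0 s j -> 0 < nth 0 s i.
  move=> /andP[ij jN] _; rewrite lt0n; apply: contraNN s_pos => /eqP <-.
  by rewrite mem_nth // sN (ltn_trans ij).
split=> [/and3P[/'forall_forallP rows /'forall_forallP cols /triple_ruleP tr]|].
  split; first by move=> _; apply/(column_increaseP down) => x y; apply/implyP.
  move=> c cB; split; last exact: tr.
  by move: c cB; apply/row_increaseP => x y; apply/implyP.
move=> [cols tr]; apply/and3P; split.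
- apply/'forall_forallP => x y; apply/implyP; move: x y; apply/row_increaseP.
  by move=> c /tr[].
- apply/'forall_forallP => x y; apply/implyP => xy.
  have B0 : 0 < B by apply: leq_ltn_trans (leq_trans (cell_col_lt x) (part_le _)).
  exact: (column_increaseP down).2 (cols B0) _ _ xy.
by apply/triple_ruleP => c /tr[].
Qed.

End Filling.

End Rectangles.

(** * Recovering shape and filling from a rectangle *)

Section Decoding.

Variables (k l N B : nat).
Implicit Types (G : nat -> 'I_N -> nat).

Definition coded G :=
  (forall c, c < B -> forall i, (G c i < k + l) || (G c i == k + l + c)) /\
  (forall c, c.+1 < B -> forall i, row_rel k (G c i) (G c.+1 i)).

Definition shape G := [seq count (fun c => G c i < k + l) (iota 0 B) | i <- enum 'I_N].

Lemma size_shape G : size (shape G) = N.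
Proof. by rewrite size_map size_enum_ord. Qed.

Lemma nth_shape G (i : 'I_N) :
  nth 0 (shape G) i = count (fun c => G c i < k + l) (iota 0 B).
Proof. by rewrite (nth_map i) ?nth_ord_enum // size_enum_ord. Qed.

Lemma nth_shape_le G i : nth 0 (shape G) i <= B.
Proof.
case: (ltnP i N) => [lt|ge]; last by rewrite nth_default ?size_shape.
rewrite -[i]/(val (Ordinal lt)) nth_shape -[X in _ <= X](size_iota 0).
exact: count_size.
Qed.

(** Rows increase, so the letters of a row, being the codes below [k + l], form an initial
    segment. *)
Lemma coded_shape G c (i : 'I_N) : coded G -> c < B ->
  (G c i < k + l) = (c < nth 0 (shape G) i).
Proof.
move=> [_ rG] cB; rewrite nth_shape.
have down b a : a <= b -> b < B -> G b i < k + l -> G a i < k + l.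
  elim: b => [|b IH]; first by rewrite leqn0 => /eqP->.
  rewrite leq_eqVlt => /orP[/eqP->//|ab] bB bi; apply: IH => //; first exact: ltnW.
  by apply: leq_ltn_trans bi; apply: (row_relW (rG _ bB i)).
(* The conjunct [c < B] makes the predicate downward closed on all naturals, although [G] is
   controlled only in columns below [B]. *)
have := @nth_sorted_count (fun c => (c < B) && (G c i < k + l)) (iota 0 B) c.
rewrite nth_iota // add0n cB /= => ->; rewrite ?size_iota ?iota_sorted //.
  by congr (_ < _); apply: eq_in_count => b; rewrite mem_iota => /andP[_ ->].
move=> a b ab /andP[bB bi]; rewrite (leq_ltn_trans ab bB).
exact: down bi.
Qed.

Lemma coded_filling G : coded G ->
  exists F : filling (shape G) k l, forall c, c < B -> rect F c =1 G c.
Proof.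
move=> cG.
(* Each entry is decoded by [split]. Quantifying over [i] with the same value as the row of [x]
   bridges the index types ['I_(size (shape G))] and ['I_N]. *)
have [f hf] : exists f : cell (shape G) -> letter k l, forall x i,
    cell_row x = val i -> unsplit (f x) = G (cell_col x) i :> nat.
  apply: (@fin_all_exists _ (fun=> letter k l) (fun x a => forall i : 'I_N,
    cell_row x = val i -> unsplit a = G (cell_col x) i :> nat)) => x.
  have xN : cell_row x < N by rewrite -(size_shape G); apply: ltn_ord.
  have lt : G (cell_col x) (Ordinal xN) < k + l.
    rewrite (coded_shape _ cG) /=; first exact: cell_col_lt.
    exact: leq_trans (cell_col_lt x) (nth_shape_le _ _).
  exists (split (Ordinal lt)) => i xi; rewrite splitK /=.
  by congr G; apply: val_inj.
exists (finfun f) => c cB i.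
case: (ltnP c (nth 0 (shape G) i)) => [/cell_exists[x [rx <-]]|ge].
  by rewrite (rect_cell _ rx) ffunE (hf _ _ rx).
rewrite rect_out //; have := cG.1 _ cB i.
by rewrite (coded_shape _ cG) // ltnNge ge => /eqP.
Qed.

Lemma coded_rect s (F : filling s k l) :
  (forall c, c.+1 < B -> forall i : 'I_N, row_rel k (rect F c i) (rect F c.+1 i)) ->
  coded (rect (N := N) F).
Proof. by split=> // c _ i; apply: rect_cases. Qed.

Lemma shape_rect s (F : filling s k l) : size s = N -> largest_part s <= B ->
  shape (rect (N := N) F) = s.
Proof.
move=> sN sB; apply: (@eq_from_nth _ 0); rewrite size_shape // => i iN.
rewrite -[i]/(val (Ordinal iN)) nth_shape.
have le : nth 0 s i <= B := leq_trans (part_le s i) sB.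
rewrite (eq_count (a2 := gtn (nth 0 s i))); last by move=> c; rewrite /= rect_lt.
rewrite -(subnKC le) iotaD count_cat add0n.
rewrite (eq_in_count (a2 := predT)); last by move=> c; rewrite mem_iota.
rewrite count_predT size_iota (eq_in_count (a2 := pred0)) ?count_pred0 ?addn0 //.
by move=> c; rewrite mem_iota /=; lia.
Qed.

(** The multiplicity of a positive [a] is the number of parts exceeding [a - 1] minus the number
    exceeding [a]; that of 0 comes from the length. *)
Lemma count_gtn_perm (s t : seq nat) : size s = size t ->
  (forall c, count (ltn c) s = count (ltn c) t) -> perm_eq s t.
Proof.
move=> st E; apply/allP => a _ /=; apply/eqP.
have H (u : seq nat) : count_mem a u + count (ltn a) u =
    if a is b.+1 then count (ltn b) u else size u.
  rewrite -count_predUI (eq_count (a2 := leq a)); last by move=> x /=; lia.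
  rewrite (eq_count (a2 := pred0) (a1 := predI _ _)); last by move=> x /=; lia.
  by rewrite count_pred0 addn0; case: a => // ; rewrite (eq_count (a2 := predT)) ?count_predT.
by apply/(@addIn (count (ltn a) t)); rewrite H -E H; case: a {H}.
Qed.

Lemma count_shape G c : coded G ->
  count (ltn c) (shape G) = (c < B) * count (gtn (k + l)) (column (G c)).
Proof.
move=> cG; case: (ltnP c B) => cB.
  rewrite mul1n !count_map; apply: eq_count => i /=.
  by rewrite (coded_shape _ cG) // nth_shape.
apply/eqP; rewrite mul0n -leqn0 leqNgt -has_count; apply/hasPn => _ /(nthP 0)[i _ <-].
by rewrite /= -leqNgt; apply: leq_trans (nth_shape_le _ _) cB.
Qed.

(** The number of letters in column [c] is the number of rows longer than [c], so column multisets
    fix the conjugate of the shape, hence the shape up to order. *)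
Lemma perm_shape G G' : coded G -> coded G' ->
  (forall c, c < B -> perm_eq (column (G c)) (column (G' c))) ->
  perm_eq (shape G) (shape G').
Proof.
move=> cG cG' E; apply: count_gtn_perm; first by rewrite !size_shape.
move=> c; rewrite !count_shape //; case: (ltnP c B) => // /E pG.
by congr (_ * _); apply/seq.permP.
Qed.

(** The shapes are not known to agree beforehand, so the fillings are compared as tagged pairs. *)
Lemma rect_inj s s' (F : filling s k l) (F' : filling s' k l) :
  size s = N -> size s' = N -> largest_part s <= B -> largest_part s' <= B ->
  (forall c, c < B -> rect (N := N) F c =1 rect F' c) ->
  Tagged (fun s => filling s k l) F = Tagged (fun s => filling s k l) F'.
Proof.
move=> sN s'N sB s'B E.
have ss' : s = s'.
  rewrite -(shape_rect F sN sB) -(shape_rect F' s'N s'B).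
  apply: eq_map => i; apply: eq_in_count => c; rewrite mem_iota => /andP[_ cB].
  by rewrite E.
case: s' / ss' F' s'N s'B E => F' _ _ E; congr Tagged; apply/ffunP => x.
have xN : cell_row x < N by rewrite -sN; apply: ltn_ord.
have cB := leq_trans (leq_trans (cell_col_lt x) (part_le _ _)) sB.
have rx : cell_row x = Ordinal xN by [].
apply: (can_inj (@unsplitK _ _)); apply: val_inj.
by rewrite /= -(rect_cell F rx) -(rect_cell F' rx) E.
Qed.

End Decoding.

(** * Column multisets as keys shared by both kinds of tableaux *)

Section Keys.

Variables (k l : nat).

Section Weight.

Local Open Scope ring_scope.

(** The default 1 applies to the codes of infinity, so products may run over whole rectangles. *)
Definition letter_weight (a : nat) : {mpoly int[k + l]} :=
  if insub a is Some i then 'X_i else 1.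

Lemma weight_cells s (F : filling s k l) :
  weight F = \prod_(x : cell s) 'X_(unsplit (F x)).
Proof.
rewrite (partition_big F predT) //= /weight.
rewrite (eq_bigr (fun a : letter k l => 'X_(unsplit a) ^+ mult F a)); last first.
  move=> a _; rewrite (eq_bigr (fun=> 'X_(unsplit a))) => [|x /eqP-> //].
  by rewrite prodr_const /mult cardsE.
by rewrite big_sumType.
Qed.

Lemma weight_key s (F : filling s k l) (N := size s) (B := largest_part s) :
  weight F = \prod_(a <- flatten (sorted_columns B (rect (N := N) F))) letter_weight a.
Proof.
rewrite weight_cells big_flatten /sorted_columns big_map /=.
rewrite (eq_bigr (fun c => \prod_(i < N) letter_weight (rect F c i))); last first.
  move=> c _; rewrite (perm_big (column (rect (N := N) F c))) ?perm_sort //=.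
  by rewrite /column big_map big_enum.
rewrite exchange_big /=.
pose tag_cell i c : cell s := Tagged (fun i : 'I_(size s) => 'I_(nth 0%N s i)) (i := i) c.
transitivity (\prod_(i < size s) \prod_(c < nth 0%N s i)
  ('X_(unsplit (F (tag_cell i c))) : {mpoly int[k + l]})).
  rewrite (sig_big_dep predT (fun=> predT)) /=.
  by apply: eq_big => -[i c].
apply: eq_bigr => i _.
(* Each row is cut at its length; the remaining factors are infinities of weight 1. *)
rewrite -[B]subn0 -/(index_iota 0 B) (big_cat_nat (n := nth 0%N s i)) ?part_le //=.
rewrite [X in _ * X]big_nat [X in _ * X]big1 ?mulr1 => [|c /andP[ic _]]; last first.
  by rewrite rect_out // /letter_weight insubF //; lia.
rewrite big_mkord; apply: eq_bigr => c _.
have -> : rect F c i = unsplit (F (tag_cell i c)).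
  by rewrite -(@rect_cell _ _ _ F N (tag_cell i c) i).
by rewrite /letter_weight valK.
Qed.

End Weight.

Variable lam : seq nat.
Hypothesis lam_part : is_partition lam.

Let N := size lam.
Let B := largest_part lam.

(** [N] and [B] come from [lam] whatever [s] is, which makes keys of different shapes comparable. *)
Definition key s (F : filling s k l) := sorted_columns B (rect (N := N) F).

Lemma perm_largest_part s : perm_eq s lam -> largest_part s = B.
Proof. by move=> p; apply: perm_big. Qed.

Lemma perm_is_HCT_rect s (F : filling s k l) : perm_eq s lam ->
  is_HCT F <-> HCT_rect k B (rect (N := N) F).
Proof.
move=> p; rewrite -(perm_largest_part p); apply: is_HCT_rect.
  exact: perm_size.
by rewrite (perm_mem p); case/andP: lam_part.
Qed.

Lemma lam_is_SSHT_rect (T : filling lam k l) :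
  is_SSHT T <-> SSHT_rect k B (rect (N := N) T).
Proof. by apply: is_SSHT_rect => //; case/andP: lam_part. Qed.

Lemma SSHT_to_HCT (T : filling lam k l) : is_SSHT T ->
  exists s (F : filling s k l), [/\ perm_eq s lam, is_HCT F & key F = key T].
Proof.
move=> /lam_is_SSHT_rect hT; have [t hG] := SSHT_rect_shuffle hT.
set G := (fun c => _ \o _) in hG.
have cG : coded k l B G.
  split=> [c _ i|c cB i]; first exact: rect_cases.
  exact: HCT_rect_row hG cB.
have cT : coded k l B (rect (N := N) T) by apply: coded_rect; case: hT.
have pGT c : c < B -> perm_eq (column (G c)) (column (rect (N := N) T c)).
  by move=> _; apply: perm_column.
have [F eF] := coded_filling cG.
have p : perm_eq (shape k l B G) lam.
  by have := perm_shape cG cT pGT; rewrite shape_rect.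
exists (shape k l B G), F; split=> //.
  apply/perm_is_HCT_rect => //; apply: HCT_rect_ext hG => c cB i.
  by rewrite eF.
apply/sorted_columnsP => c cB; apply: perm_trans (pGT c cB).
by rewrite /column (eq_map (eF c cB)).
Qed.

Lemma HCT_to_SSHT s (F : filling s k l) : perm_eq s lam -> is_HCT F ->
  exists2 T : filling lam k l, is_SSHT T & key T = key F.
Proof.
move=> p /(perm_is_HCT_rect _ p) hF; have hG := HCT_rect_sort hF.
set G := (fun c => sorted_column _) in hG.
have cG : coded k l B G.
  split=> [c _ i|]; last by case: hG.
  by rewrite /G; have [t ->] := sorted_columnP (rect (N := N) F c); apply: rect_cases.
have cF : coded k l B (rect (N := N) F).
  by apply: coded_rect => c cB i; apply: HCT_rect_row hF cB.
have pGF c : c < B -> perm_eq (column (G c)) (column (rect (N := N) F c)).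
  by move=> _; rewrite column_sorted_column perm_sort.
have slam : shape k l B G = lam.
  have geq_trans : transitive geq by move=> n m q /= nm qn; apply: leq_trans nm.
  apply: (sorted_eq geq_trans).
  - by move=> m n /= mn; apply/anti_leq; rewrite andbC.
  - apply/(sortedP 0) => i; rewrite size_shape => iN.
    rewrite /= leqNgt; apply/negP => lt.
    (* If row [i.+1] were longer than row [i], take the first column [c] beyond row [i]: the letter
       in row [i.+1] would bound the entry below it, which is an infinity. *)
    set c := nth 0 (shape k l B G) i in lt.
    have cB : c < B := leq_trans lt (nth_shape_le _ _ _ _ _).
    have := coded_shape (Ordinal (ltnW iN)) cG cB; rewrite ltnn.
    have := coded_shape (Ordinal iN) cG cB; rewrite lt.
    have /row_rel_total : ~~ row_rel k (G c (Ordinal iN)) (G c (Ordinal (ltnW iN))).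
      by case: hG => s0 _; apply: (s0 _ cB) => /=.
    by move=> le /(leq_ltn_trans le) ->.
  - by case/andP: lam_part.
  - apply: perm_trans (perm_shape cG cF pGF) _.
    by rewrite shape_rect ?(perm_size p) ?(perm_largest_part p).
have [T eT] := coded_filling cG.
move: T eT; rewrite slam => T eT; exists T.
  by apply/lam_is_SSHT_rect; apply: SSHT_rect_ext hG => c cB i; rewrite eT.
apply/sorted_columnsP => c cB; apply: perm_trans (pGF c cB).
by rewrite /column (eq_map (eT c cB)).
Qed.

Lemma key_inj s s' (F : filling s k l) (F' : filling s' k l) :
  perm_eq s lam -> perm_eq s' lam ->
  (forall c, c < B -> rect (N := N) F c =1 rect F' c) ->
  Tagged (fun s => filling s k l) F = Tagged (fun s => filling s k l) F'.
Proof.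
move=> p p'; apply: rect_inj; rewrite ?(perm_size p) ?(perm_size p') //.
  by rewrite perm_largest_part.
by rewrite perm_largest_part.
Qed.

(** Keys determine fillings, on the right even the shape, so neither list has repetitions; the two
    constructions above show that the lists have the same members. *)
Lemma perm_keys :
  perm_eq [seq key T | T : filling lam k l <- enum (@is_SSHT lam k l)]
    [seq key F | s <- permutations lam, F <- enum (@is_HCT s k l)].
Proof.
apply: uniq_perm.
- rewrite map_inj_in_uniq ?enum_uniq // => T T'.
  rewrite !mem_enum => /lam_is_SSHT_rect hT /lam_is_SSHT_rect hT' E.
  have := key_inj (perm_refl lam) (perm_refl lam) (SSHT_rect_inj hT hT' E).
  by move/eqP; rewrite eq_Tagged /= => /eqP.
- apply: allpairs_uniq_dep => [|s _|]; rewrite ?permutations_uniq ?enum_uniq //.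
  move=> _ _ /allpairsPdep[s [F [+ + ->]]] /allpairsPdep[s' [F' [+ + ->]]] /=.
  rewrite !mem_permutations !mem_enum => p hF p' hF' E.
  move: hF hF' => /(perm_is_HCT_rect _ p) hF /(perm_is_HCT_rect _ p') hF'.
  exact: key_inj p p' (HCT_rect_inj hF hF' E).
move=> x; apply/mapP/allpairsPdep => [[T]|[s [F []]]].
  rewrite mem_enum => /SSHT_to_HCT[s [F [p hF e]]] ->.
  by exists s, F; rewrite mem_permutations mem_enum.
rewrite mem_permutations mem_enum => p /(HCT_to_SSHT p)[T hT e] ->.
by exists T; rewrite ?mem_enum.
Qed.

End Keys.

Theorem theorem3p1 (k l : nat) (lam : seq nat) (lam_part : is_partition lam) :
  HS k l lam = (\sum_(alpha <- compositions_sorting_to lam) HQ k l alpha)%R.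
Proof.
(* The weight is a function of the key, so each side becomes a sum of [W] over a list of keys. *)
pose W x := (\prod_(a <- flatten x) letter_weight k l a)%R.
have wE s (F : filling s k l) : perm_eq s lam -> weight F = W (key lam F).
  by move=> p; rewrite weight_key (perm_size p) (perm_largest_part p).
transitivity (\sum_(x <- [seq key lam T | T <- enum (@is_SSHT lam k l)]) W x)%R.
  rewrite big_map big_enum /=; apply: eq_bigr => T _; exact: wE.
rewrite (perm_big _ (perm_keys k l lam_part)) /= big_allpairs_dep.
rewrite [LHS]big_seq [RHS]big_seq; apply: eq_bigr => s.
rewrite mem_permutations => p; rewrite big_enum; apply: eq_bigr => F _.
by rewrite wE.
Qed.
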